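(* If $\underline{\beta} < 0$, then every point $(x,u,y,z,t) \in T$ satisfies $$(\underline{\gamma} - \underline{\beta})(\overline{\gamma} x - u) \leq -\underline{\beta} (\overline{\gamma} - t).$$
   Context: Let $\underline{\gamma} \le \overline{\gamma}$ and $\underline{\beta} \le \overline{\beta}$ be real parameters. The set $T \subseteq \mathbb{R}^5$ consists of all $(x,u,y,z,t)$ satisfying $$u = x t,\quad y + u \le 0,\quad z + x \le 1,\quad y \le \overline{\beta} z,\quad y \ge \underline{\beta} z,\quad z \ge 0,\quad x \in [0,1],\quad t \in [\underline{\gamma}, \overline{\gamma}].$$ *)

(* Defs.v *)
From mathcomp Require Import all_boot all_order all_algebra.
From mathcomp Require Import classical_sets reals.

Set Implicit Arguments.
Unset Strict Implicit.
Unset Printing Implicit Defensive.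

Import Order.TTheory GRing.Theory Num.Theory.

Local Open Scope ring_scope.
Local Open Scope classical_set_scope.

(* Points of R^5 are written (x, u, y, z, t); gl, gu are the lower and upper
   gamma, and bl, bu the lower and upper beta. *)
Definition T (R : realType) (gl gu bl bu : R) : set (R * R * R * R * R) :=
  [set p | let: (x, u, y, z, t) := p in
    [/\ u = x * t, y + u <= 0 & z + x <= 1] /\
    [/\ y <= bu * z, y >= bl * z & z >= 0] /\
    0 <= x <= 1 /\ gl <= t <= gu].

(* Main.v *)
Require Import Defs.
From mathcomp Require Import all_boot all_order all_algebra.
From mathcomp Require Import classical_sets reals.
From mathcomp Require Import ring lra.

(** Since [u = x * t], the left-hand side is [(gl - bl) * x * (gu - t)], so the
    inequality is the product of [(gl - bl) * x <= - bl] with the nonnegative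
    factor [gu - t]. The linear bound says that [T] forces [x] to be small:
    [y + u <= 0] and [bl * z <= y] give [x * t <= - bl * z], and, as [- bl] is
    positive, [z <= 1 - x] turns this into [x * (t - bl) <= - bl]; finally
    [gl <= t] and [0 <= x] allow [t] to be replaced by [gl]. *)

Set Implicit Arguments.
Unset Strict Implicit.
Unset Printing Implicit Defensive.

Import Order.TTheory GRing.Theory Num.Theory.

Local Open Scope ring_scope.
Local Open Scope classical_set_scope.

Theorem theorem3p6 (R : realType) (gl gu bl bu : R)
    (hg : gl <= gu) (hb : bl <= bu) (hbl : bl < 0) (x u y z t : R)
    (hT : T gl gu bl bu (x, u, y, z, t)) :
  (gl - bl) * (gu * x - u) <= - bl * (gu - t).
Proof.
have [[u_xt yu_le0 zx_le1] [[_ y_ge _] [/andP[x_ge0 _] /andP[gl_t t_gu]]]] := hT.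
rewrite {}u_xt in yu_le0 *.
have gl_x : gl * x <= t * x by rewrite ler_wpM2r.
have bl_z : - bl * z <= - bl * (1 - x).
  by rewrite ler_wpM2l ?oppr_ge0 ?(ltW hbl) // lerBrDr.
have x_small : (gl - bl) * x <= - bl by lra.
have -> : (gl - bl) * (gu * x - x * t) = (gl - bl) * x * (gu - t) by ring.
by rewrite ler_wpM2r // subr_ge0.
Qed.
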